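(* $\mathcal D$ is a model of the $\partial\lambda$-calculus with tests: for all sums of expressions $\mathbb A,\mathbb B$ and every repetition-free list $\vec x$ of variables containing the free variables of $\mathbb A$, if $\mathbb A\twoheadrightarrow\mathbb B$ then $\llbracket\mathbb A\rrbracket_{\vec x}=\llbracket\mathbb B\rrbracket_{\vec x}$.
   Context: Syntax of the $\partial\lambda$-calculus with tests. Terms $M,N,L$, bags $P$, tests $V,W$: $M::=x\mid\lambda x.M\mid MP\mid\bar\tau(V)$, $P::=[L_1,\dots,L_k,\mathbb N^{!}]$, $V::=\tau[L_1,\dots,L_k]$ ($k\ge0$), where $\mathbb N$ is a finite sum of terms; up to $\alpha$-equivalence. Sums of each sort are finite formal sums with idempotent addition, $0$ the empty sum. Bag union: $[L_1,\dots,L_k,\mathbb N^!]\uplus[L'_1,\dots,L'_h,\mathbb M^!]=[L_1,\dots,L_k,L'_1,\dots,L'_h,(\mathbb N+\mathbb M)^!]$; $[L_1,\dots,L_k]$ stands for $[L_1,\dots,L_k,0^!]$. $\varepsilon:=\tau[\,]$, $V\mid W$ multiset union of tests. Constructors are extended to sums multilinearly (constructors applied to $0$ give $0$), except that the promoted component is not distributed: $[\vec L,(\mathbb N+\mathbb M)^!]\ne[\vec L,\mathbb N^!]+[\vec L,\mathbb M^!]$. $A\{\mathbb N/x\}$ replaces each free occurrence of $x$ by $\mathbb N$. Linear substitution: $x\langle N/x\rangle=N$, $y\langle N/x\rangle=0$ ($y\ne x$), $(\lambda y.M)\langle N/x\rangle=\lambda y.M\langle N/x\rangle$, $(MP)\langle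 N/x\rangle=M\langle N/x\rangle P+M(P\langle N/x\rangle)$, $\bar\tau(V)\langle N/x\rangle=\bar\tau(V\langle N/x\rangle)$, $\tau[L_1,\dots,L_k]\langle N/x\rangle=\sum_i\tau[L_1,\dots,L_i\langle N/x\rangle,\dots,L_k]$, $[L_1,\dots,L_k,\mathbb N^!]\langle N/x\rangle=\sum_i[L_1,\dots,L_i\langle N/x\rangle,\dots,L_k,\mathbb N^!]+[L_1,\dots,L_k,\mathbb N\langle N/x\rangle,\mathbb N^!]$, bilinear on sums; $A\langle[L_1,\dots,L_k]/x\rangle:=A\langle L_1/x\rangle\cdots\langle L_k/x\rangle$. Reduction rules: $(\lambda x.M)[L_1,\dots,L_k,\mathbb N^!]\to M\langle[L_1,\dots,L_k]/x\rangle\{\mathbb N/x\}$; $\bar\tau(V)[L_1,\dots,L_k,\mathbb N^!]\to\bar\tau(V)$ if $k=0$, $\to0$ otherwise; $\tau[\lambda x.M]\mid V\to\tau[M\{0/x\}]\mid V$; $\tau[\bar\tau(V)]\mid W\to V\mid W$. $\to$ is their closure under all syntactic positions (including inside a promoted sum: $[(M+\mathbb N)^!]\uplus P\to[(\mathbb M+\mathbb N)^!]\uplus P$ when $M\to\mathbb M$) and under sums; $\twoheadrightarrow$ is the reflexive-transitive closure. The model $\mathcal D$. $\mathcal M_f(S)$ = finite multisets over $S$; $D_0=\emptyset$, $D_{n+1}$ = $\mathbb N$-indexed sequences $(a_1,a_2,\dots)$ of elements of $\mathcal M_f(D_n)$ with all but finitely many empty; $\mathcal D=\bigcup_nD_n$;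 $a::(a_1,a_2,\dots):=(a,a_1,a_2,\dots)$; $*:=([\,],[\,],\dots)$; $\uplus$ on tuples componentwise. For a repetition-free list $\vec x=x_1,\dots,x_n$ containing the free variables: $\llbracket x_i\rrbracket_{\vec x}=\{(([\,],\dots,[\alpha],\dots,[\,]),\alpha):\alpha\in\mathcal D\}$; $\llbracket\lambda y.M\rrbracket_{\vec x}=\{(\vec a,b::\alpha):((\vec a,b),\alpha)\in\llbracket M\rrbracket_{\vec x,y}\}$; $\llbracket MP\rrbracket_{\vec x}=\{(\vec a_1\uplus\vec a_2,\alpha):\exists b\,(\vec a_1,b::\alpha)\in\llbracket M\rrbracket_{\vec x},(\vec a_2,b)\in\llbracket P\rrbracket_{\vec x}\}$; $\llbracket\bar\tau(V)\rrbracket_{\vec x}=\{(\vec a,* ):\vec a\in\llbracket V\rrbracket_{\vec x}\}$; $\llbracket[L_1,\dots,L_k,\mathbb N^!]\rrbracket_{\vec x}=\{(\biguplus_{r=1}^{k+m}\vec a_r,[\beta_1,\dots,\beta_{k+m}]):m\ge0,(\vec a_j,\beta_j)\in\llbracket L_j\rrbracket_{\vec x}\ (j\le k),(\vec a_i,\beta_i)\in\llbracket\mathbb N\rrbracket_{\vec x}\ (k<i\le k+m)\}$; $\llbracket\tau[L_1,\dots,L_k]\rrbracket_{\vec x}=\{\biguplus_i\vec a_i:(\vec a_i,* )\in\llbracket L_i\rrbracket_{\vec x}\}$; sums as unions. *)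

(* Defs.v *)
From HB Require Import structures.
From Stdlib Require List Permutation.
From mathcomp Require Import all_boot.
From mathcomp Require Import finmap multiset.
From mathcomp Require Import classical_sets.

Set Implicit Arguments.
Unset Strict Implicit.
Unset Printing Implicit Defensive.

(* * Syntax                                                                   *)

(* Terms up to alpha-equivalence are de Bruijn terms.  Free variables are     *)
(* named by natural numbers: at top level, the variable named x is [Var x].   *)
(* Finite multisets and finite formal sums are both represented by lists; the *)
(* identification of lists denoting the same multiset (resp. the same         *)
(* idempotent sum), at every depth, is the relation [eqv] (resp. [sum_eqv])   *)
(* below, modulo which reduction is defined.                                  *)

Inductive kind := Tm | Bg | Ts.

Inductive expr : kind -> Type :=
| Var (x : nat) : expr Tm
| Lam (M : expr Tm) : expr Tm
| App (M : expr Tm) (P : expr Bg) : expr Tm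
| TauBar (V : expr Ts) : expr Tm
(* [Bag L N] is the bag [L_1, ..., L_k, N^!], where the list N is a sum       *)
| Bag (L N : seq (expr Tm)) : expr Bg
| Tau (L : seq (expr Tm)) : expr Ts.

Notation sums s := (seq (expr s)).

(* The sum over all sequences obtained by picking one summand in each sum.    *)
Definition multilin (T : Type) (Ss : seq (seq T)) : seq (seq T) :=
  foldr (fun S r => [seq a :: l | a <- S, l <- r]) [:: [::]] Ss.

(* \sum_i [L_1, ..., f L_i, ..., L_k], extended linearly in f L_i             *)
Definition one_at (T : Type) (f : T -> seq T) : seq T -> seq (seq T) :=
  fix one_at L := if L is a :: l
    then [seq b :: l | b <- f a] ++ [seq a :: l' | l' <- one_at l]
    else [::].

Fixpoint fv s (e : expr s) : seq nat :=
  match e with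
  | Var x => [:: x]
  | Lam M => [seq x.-1 | x <- fv M & x != 0]
  | App M P => fv M ++ fv P
  | TauBar V => fv V
  | Bag L N => flatten [seq fv M | M <- L] ++ flatten [seq fv M | M <- N]
  | Tau L => flatten [seq fv M | M <- L]
  end.

Definition fv_sum s (A : sums s) : seq nat := flatten [seq fv a | a <- A].

Fixpoint lift (k : nat) s (e : expr s) : expr s :=
  match e in expr s return expr s with
  | Var x => Var (bump k x)
  | Lam M => Lam (lift k.+1 M)
  | App M P => App (lift k M) (lift k P)
  | TauBar V => TauBar (lift k V)
  | Bag L N => Bag [seq lift k M | M <- L] [seq lift k M | M <- N]
  | Tau L => Tau [seq lift k M | M <- L]
  end.

(* A{N/k}: the variable k disappears, so the variables above it are lowered,  *)
(* and N lives in the scope without k.                                        *)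
Fixpoint subst (k : nat) (N : sums Tm) s (e : expr s) : sums s :=
  match e in expr s return sums s with
  | Var x => if x == k then N else [:: Var (unbump k x)]
  | Lam M => [seq Lam M' | M' <- subst k.+1 [seq lift 0 n | n <- N] M]
  | App M P => [seq App M' P' | M' <- subst k N M, P' <- subst k N P]
  | TauBar V => [seq TauBar V' | V' <- subst k N V]
  | Bag L B => [seq Bag L' (flatten [seq subst k N M | M <- B])
               | L' <- multilin [seq subst k N M | M <- L]]
  | Tau L => [seq Tau L' | L' <- multilin [seq subst k N M | M <- L]]
  end.

(* A<N/k>: the variable k may still occur afterwards, so nothing is lowered,  *)
(* and N lives in the same scope as A.                                        *)
Fixpoint lin (k : nat) (N : expr Tm) s (e : expr s) : sums s :=
  match e in expr s return sums s with
  | Var x => if x == k then [:: N] else [::]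
  | Lam M => [seq Lam M' | M' <- lin k.+1 (lift 0 N) M]
  | App M P => [seq App M' P | M' <- lin k N M]
            ++ [seq App M P' | P' <- lin k N P]
  | TauBar V => [seq TauBar V' | V' <- lin k N V]
  | Bag L B => [seq Bag L' B | L' <- one_at (@lin k N Tm) L]
            ++ [seq Bag (rcons L M') B
               | M' <- flatten [seq lin k N M | M <- B]]
  | Tau L => [seq Tau L' | L' <- one_at (@lin k N Tm) L]
  end.

(* M<[L_1, ..., L_k]/0>, where the L_i live outside the scope of variable 0.  *)
Definition lin_bag (M : expr Tm) (L : seq (expr Tm)) : sums Tm :=
  foldl (fun S N => flatten [seq lin 0 (lift 0 N) M' | M' <- S]) [:: M] L.

Definition sub_sum (T : Type) (R : T -> T -> Prop) (A B : seq T) : Prop :=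
  forall a, List.In a A -> exists2 b, List.In b B & R a b.

Inductive eqv : forall s, expr s -> expr s -> Prop :=
| eqv_var x : eqv (Var x) (Var x)
| eqv_lam M M' : eqv M M' -> eqv (Lam M) (Lam M')
| eqv_app M M' P P' : eqv M M' -> eqv P P' -> eqv (App M P) (App M' P')
| eqv_taubar V V' : eqv V V' -> eqv (TauBar V) (TauBar V')
| eqv_bag L L1 L' N N' :
    Permutation.Permutation L L1 -> List.Forall2 (@eqv Tm) L1 L' ->
    sub_sum (@eqv Tm) N N' -> sub_sum (fun M' M => @eqv Tm M M') N' N ->
    eqv (Bag L N) (Bag L' N')
| eqv_tau L L1 L' :
    Permutation.Permutation L L1 -> List.Forall2 (@eqv Tm) L1 L' ->
    eqv (Tau L) (Tau L').

Definition sum_eqv s (A B : sums s) : Prop :=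
  sub_sum (@eqv s) A B /\ sub_sum (fun b a => @eqv s a b) B A.

(* * Reduction                                                                *)

(* Redexes and contexts are only given at the head of lists: since [step]     *)
(* below works up to [sum_eqv], this covers all positions.                    *)
Inductive red : forall s, expr s -> sums s -> Prop :=
| red_beta M L N :
    red (App (Lam M) (Bag L N)) (flatten [seq subst 0 N M' | M' <- lin_bag M L])
| red_taubar_nil V N : red (App (TauBar V) (Bag [::] N)) [:: TauBar V]
| red_taubar_cons V M L N : red (App (TauBar V) (Bag (M :: L) N)) [::]
| red_tau_lam M L : red (Tau (Lam M :: L)) [seq Tau (M' :: L) | M' <- subst 0 [::] M]
| red_tau_taubar L L' : red (Tau (TauBar (Tau L) :: L')) [:: Tau (L ++ L')]
| red_lam M MM : red M MM -> red (Lam M) [seq Lam M' | M' <- MM]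
| red_appl M P MM : red M MM -> red (App M P) [seq App M' P | M' <- MM]
| red_appr M P PP : red P PP -> red (App M P) [seq App M P' | P' <- PP]
| red_taubar V VV : red V VV -> red (TauBar V) [seq TauBar V' | V' <- VV]
| red_bag M L N MM : red M MM -> red (Bag (M :: L) N) [seq Bag (M' :: L) N | M' <- MM]
| red_bang M L N MM : red M MM -> red (Bag L (M :: N)) [:: Bag L (MM ++ N)]
| red_tau M L MM : red M MM -> red (Tau (M :: L)) [seq Tau (M' :: L) | M' <- MM].

Definition step s (A B : sums s) : Prop :=
  exists a S C, [/\ sum_eqv A (a :: C), red a S & sum_eqv B (S ++ C)].

Inductive steps s : sums s -> sums s -> Prop :=
| steps_refl A B : sum_eqv A B -> steps A B
| steps_step A B C : step A B -> steps B C -> steps A C.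

(* * The set D                                                                *)

(* An element of D is a hereditarily finite sequence of multisets.  It is     *)
(* coded by the unique normal form of a finite tree: inner lists are sorted,  *)
(* and trailing empty lists are removed.  The lemmas [Dseq_fin], [Dseq_ext],  *)
(* [Dseq_mk] and [Dstage_ex] say that D is the union of the stages D_n.       *)

Inductive tree := Node of seq (seq tree).

Definition subtrees (t : tree) : seq (seq tree) := let: Node ss := t in ss.

Definition tree_all (P : tree -> Prop) (ss : seq (seq tree)) : Prop :=
  foldr (fun s Q => foldr (fun t Q' => P t /\ Q') True s /\ Q) True ss.

Fixpoint tree_ind' (P : tree -> Prop)
    (H : forall ss, tree_all P ss -> P (Node ss)) (t : tree) : P t :=
  let: Node ss := t in
  H ss ((fix all_ss ss : tree_all P ss :=
    if ss is s :: ss' return tree_all P ss then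
      conj ((fix all_s s : foldr (fun t Q => P t /\ Q) True s :=
        if s is t :: s' return foldr (fun t Q => P t /\ Q) True s
        then conj (tree_ind' H t) (all_s s') else I) s) (all_ss ss')
    else I) ss).

Lemma tree_all_map (T : Type) (P : tree -> Prop) (f g : tree -> T) ss :
  (forall t, P t -> f t = g t) -> tree_all P ss ->
  [seq map f s | s <- ss] = [seq map g s | s <- ss].
Proof.
move=> fg; elim: ss => //= s ss IH [Ps /IH ->]; congr (_ :: _).
by elim: s Ps => //= t s IHs [/fg -> /IHs ->].
Qed.

Fixpoint tree_encode (t : tree) : GenTree.tree nat :=
  let: Node ss := t in
  GenTree.Node 0 [seq GenTree.Node 0 [seq tree_encode u | u <- s] | s <- ss].

Fixpoint tree_decode (g : GenTree.tree nat) : tree :=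
  match g with
  | GenTree.Leaf _ => Node [::]
  | GenTree.Node _ gs =>
      Node [seq (if g is GenTree.Node _ hs
                 then [seq tree_decode h | h <- hs] else [::]) | g <- gs]
  end.

Lemma tree_encodeK : cancel tree_encode tree_decode.
Proof.
elim/tree_ind' => ss IH /=; congr Node; rewrite -map_comp /=.
rewrite (eq_map (g := map (tree_decode \o tree_encode))); last first.
  by move=> s /=; rewrite -map_comp.
rewrite (tree_all_map (g := id) _ IH) //.
by rewrite (eq_map (g := id)) ?map_id // => s; rewrite map_id.
Qed.

HB.instance Definition _ := Countable.copy tree (can_type tree_encodeK).

Fixpoint trim (T : Type) (ss : seq (seq T)) : seq (seq T) :=
  if ss is s :: ss' then
    let tt := trim ss' in if nilp s && nilp tt then [::] else s :: tt
  else [::].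

Lemma nth_trim (T : Type) (ss : seq (seq T)) i :
  nth [::] (trim ss) i = nth [::] ss i.
Proof.
elim: ss i => //= s ss IH [|i]; case: ifP => //= /andP[/nilP sE /nilP tE].
  by rewrite sE.
by rewrite -IH tE nth_nil.
Qed.

Lemma trim_ext (T : Type) (ss tt : seq (seq T)) :
  (forall i, nth [::] ss i = nth [::] tt i) -> trim ss = trim tt.
Proof.
have nil_ext (uu : seq (seq T)) : (forall i, nth [::] uu i = [::]) -> trim uu = [::].
  elim: uu => //= u uu IH uu0; rewrite (IH (fun i => uu0 i.+1)).
  by have /= -> := uu0 0.
elim: ss tt => [|s ss IH] [|t tt] //= E.
- have tt0 i : nth [::] (t :: tt) i = [::] by rewrite -E nth_nil.
  by have /= -> := nil_ext _ tt0.
- have ss0 i : nth [::] (s :: ss) i = [::] by rewrite E nth_nil.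
  by have /= -> := nil_ext _ ss0.
by rewrite (IH tt (fun i => E i.+1)); have /= -> := E 0.
Qed.

Definition tree_le (t u : tree) : bool := choice.pickle t <= choice.pickle u.

Fixpoint norm (t : tree) : tree :=
  let: Node ss := t in
  Node (trim [seq path.sort tree_le [seq norm u | u <- s] | s <- ss]).

Lemma sort_treeP (s s' : seq tree) :
  reflect (path.sort tree_le s = path.sort tree_le s') (perm_eq s s').
Proof.
apply: perm_sortP => [t u|t u v|t u]; rewrite /tree_le.
- exact: leq_total.
- exact: leq_trans.
- by rewrite -eqn_leq => /eqP /(pcan_inj choice.pickleK).
Qed.

Lemma nth_norm (t : tree) i :
  nth [::] (subtrees (norm t)) i =
  path.sort tree_le [seq norm u | u <- nth [::] (subtrees t) i].
Proof.
case: t => ss /=; rewrite nth_trim; case: (ltnP i (size ss)) => [lt_i|ge_i].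
  by rewrite (nth_map [::]).
by rewrite !nth_default ?size_map.
Qed.

Lemma norm_ext (t u : tree) :
  (forall i, perm_eq [seq norm v | v <- nth [::] (subtrees t) i]
                     [seq norm v | v <- nth [::] (subtrees u) i]) ->
  norm t = norm u.
Proof.
case: t u => [ss] [tt] E; congr Node; apply: trim_ext => i.
have := nth_norm (Node ss) i; have := nth_norm (Node tt) i.
rewrite /= !nth_trim => -> ->; exact/sort_treeP/E.
Qed.

Lemma norm_idem (t : tree) : norm (norm t) = norm t.
Proof.
elim/tree_ind': t => ss IH; apply: norm_ext => i; rewrite nth_norm.
have {}IH : [seq norm (norm u) | u <- nth [::] ss i] = [seq norm u | u <- nth [::] ss i].
  have := tree_all_map (f := norm \o norm) (g := norm) (fun t E => E) IH.
  case: (ltnP i (size ss)) => [lt_i|ge_i]; last by rewrite nth_default.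
  by move/(congr1 (fun l => nth [::] l i)); rewrite !(nth_map [::]).
by rewrite -[X in perm_eq _ X]IH (map_comp norm norm); apply: perm_map; rewrite perm_sort.
Qed.

Definition D : Type := {t : tree | norm t == t}.
HB.instance Definition _ := Countable.on D.

Definition to_D (t : tree) : D := exist _ (norm t) (introT eqP (norm_idem t)).

Local Open Scope mset_scope.

(* The components of d up to the last nonempty one.                           *)
Definition Dlist (d : D) : seq {mset D} :=
  [seq seq_mset [seq to_D u | u <- s] | s <- subtrees (val d)].

Definition Dseq (d : D) (i : nat) : {mset D} := nth mset0 (Dlist d) i.

(* The sequence (a_1, ..., a_n, [], [], ...). *)
Definition mkD (s : seq {mset D}) : D :=
  to_D (Node [seq [seq val e | e <- enum_mset a] | a <- s]).

Definition Dstar : D := mkD [::].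
Definition Dcons (a : {mset D}) (d : D) : D := mkD (a :: Dlist d).

Fixpoint Dstage (n : nat) (d : D) : Prop :=
  if n is m.+1 then forall i e, e \in Dseq d i -> Dstage m e else False.

Lemma val_to_D (t : tree) : val (to_D t) = norm t.
Proof. by []. Qed.

Lemma seq_mset_nil : seq_mset [::] = mset0 :> {mset D}.
Proof. by apply/msetP => e; rewrite mset_seqE mset0E. Qed.

Lemma DseqE d i : Dseq d i = seq_mset [seq to_D u | u <- nth [::] (subtrees (val d)) i].
Proof.
rewrite /Dseq /Dlist; case: (ltnP i (size (subtrees (val d)))) => [lt_i|ge_i].
  by rewrite (nth_map [::]).
by rewrite !nth_default ?size_map //= seq_mset_nil.
Qed.

Lemma Dseq_fin d : exists n, forall i, n <= i -> Dseq d i = mset0.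
Proof.
by exists (size (Dlist d)) => i le_i; rewrite /Dseq nth_default.
Qed.

Lemma Dseq_mk (s : seq {mset D}) i : Dseq (mkD s) i = nth mset0 s i.
Proof.
rewrite DseqE val_to_D nth_norm /=.
have -> : nth [::] [seq [seq val e | e <- enum_mset a] | a <- s] i
        = [seq val e | e <- enum_mset (nth mset0 s i)].
  case: (ltnP i (size s)) => [lt_i|ge_i]; first by rewrite (nth_map mset0).
  by rewrite !nth_default ?size_map // enum_mset0.
rewrite -{2}[nth mset0 s i]seq_mset_id; apply/eq_seq_msetP.
rewrite -[X in perm_eq _ X]map_id -(eq_map (f := to_D \o (norm \o val))); last first.
  by move=> e /=; apply/val_inj; rewrite /= (eqP (valP e)) (eqP (valP e)).
by rewrite (map_comp to_D); apply: perm_map; rewrite perm_sort (map_comp norm).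
Qed.

Lemma Dseq_ext d e : (forall i, Dseq d i = Dseq e i) -> d = e.
Proof.
move=> E; apply/val_inj; rewrite /= -(eqP (valP d)) -(eqP (valP e)).
apply: norm_ext => i; have := E i; rewrite !DseqE => /eq_seq_msetP.
by move=> /(perm_map val); rewrite -!map_comp; congr perm_eq; apply: eq_map.
Qed.

Lemma Dseq_star i : Dseq Dstar i = mset0.
Proof. by rewrite Dseq_mk nth_nil. Qed.

Lemma Dseq_cons0 a d : Dseq (Dcons a d) 0 = a.
Proof. by rewrite Dseq_mk. Qed.

Lemma Dseq_consS a d i : Dseq (Dcons a d) i.+1 = Dseq d i.
Proof. by rewrite Dseq_mk. Qed.

Lemma DstageS n d : Dstage n d -> Dstage n.+1 d.
Proof.
by elim: n d => // n IH d /= H i e /H /IH.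
Qed.

Lemma Dstage_le m n d : m <= n -> Dstage m d -> Dstage n d.
Proof. by move/subnKC <-; elim: (n - m) => [|k IH]; rewrite ?addn0 // addnS => /IH /DstageS. Qed.

Lemma Dstage_ex d : exists n, Dstage n d.
Proof.
suff H t : exists n, Dstage n (to_D t).
  by have [n] := H (val d); exists n; rewrite (_ : d = to_D (val d)) //;
    apply/val_inj; rewrite /= (eqP (valP d)).
elim/tree_ind': t => ss IH.
have [n Hn] : exists n, tree_all (fun t => Dstage n (to_D t)) ss.
  elim: ss IH => [|s ss IHss] /=; first by exists 0.
  move=> [Hs /IHss[n Hn]].
  have {Hs} [m Hm] : exists m, foldr (fun t Q => Dstage m (to_D t) /\ Q) True s.
    elim: s => [|t s IHs] /= in Hs *; first by exists 0.
    case: Hs => [[k Hk] /IHs[m Hm]]; exists (maxn k m).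
    split; first exact: Dstage_le (leq_maxl _ _) Hk.
    elim: {IHs} s Hm => //= u s IHs [Hu /IHs ?]; split=> //.
    exact: Dstage_le (leq_maxr _ _) Hu.
  exists (maxn m n); split.
    elim: s Hm => //= u s IHs [Hu /IHs ?]; split=> //.
    exact: Dstage_le (leq_maxl _ _) Hu.
  elim: {IHss} ss Hn => //= s' ss IHss [Hs /IHss ?]; split=> //.
  elim: s' Hs => //= u s' IHs [Hu /IHs ?]; split=> //.
  exact: Dstage_le (leq_maxr _ _) Hu.
exists n.+1 => i e; rewrite DseqE val_to_D nth_norm.
rewrite (perm_mem (perm_eq_seq_mset _)) => /mapP[u].
rewrite mem_sort => /mapP[v Hv ->] ->.
have -> : to_D (norm v) = to_D v by apply/val_inj/norm_idem.
have Hs : foldr (fun t Q => Dstage n (to_D t) /\ Q) True (nth [::] ss i).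
  by elim: ss i Hn {IH Hv} => [|s ss IHss] [|i] //= [Hs Hn] //; apply: IHss.
rewrite /= in Hv; elim: (nth [::] ss i) Hv Hs => //= w s IHs.
by rewrite in_cons => /orP[/eqP -> []|/IHs H [_ /H]].
Qed.

(* * Interpretation                                                           *)

Section Tuples.
Variable n : nat.

Definition tzero : n.-tuple {mset D} := [tuple mset0 | _ < n].
Definition tsingle (i : 'I_n) (d : D) : n.-tuple {mset D} :=
  [tuple if j == i then [mset d] else mset0 | j < n].
Definition tadd (a b : n.-tuple {mset D}) : n.-tuple {mset D} :=
  [tuple tnth a i `+` tnth b i | i < n].
Definition tsum (s : seq (n.-tuple {mset D})) : n.-tuple {mset D} :=
  foldr tadd tzero s.

End Tuples.

Definition point (s : kind) (n : nat) : Type :=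
  match s with
  | Tm => (n.-tuple {mset D} * D)%type
  | Bg => (n.-tuple {mset D} * {mset D})%type
  | Ts => n.-tuple {mset D}
  end.

Local Open Scope classical_set_scope.

Definition unions (T : Type) (Xs : seq (set T)) : set T :=
  \big[setU/set0]_(X <- Xs) X.

Definition bag_interp n (Ls : seq (set (point Tm n))) (N : set (point Tm n)) :
    set (point Bg n) :=
  [set p | exists ps qs : seq (point Tm n),
     [/\ List.Forall2 (fun X q => X q) Ls ps, (forall q, List.In q qs -> N q) &
         p = (tsum [seq q.1 | q <- ps ++ qs], seq_mset [seq q.2 | q <- ps ++ qs])]].

Definition test_interp n (Ls : seq (set (point Tm n))) : set (point Ts n) :=
  [set a | exists2 s : seq (n.-tuple {mset D}),
     List.Forall2 (fun X b => X (b, Dstar)) Ls s & a = tsum s].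

(* In the abstraction case the list x_1, ..., x_n, y becomes                  *)
(* x_1 + 1, ..., x_n + 1, 0, as the bound variable y is index 0 in M.         *)
Fixpoint interp s (e : expr s) n (xs : n.-tuple nat) : set (point s n) :=
  match e in expr s return set (point s n) with
  | Var x => [set p | exists i d, tnth xs i = x /\ p = (tsingle i d, d)]
  | Lam M => [set p | exists (a : n.-tuple {mset D}) b d, p = (a, Dcons b d) /\
      interp M [tuple of rcons [tuple of map S xs] 0] ([tuple of rcons a b], d)]
  | App M P => [set p | exists a1 a2 b d, [/\ p = (tadd a1 a2, d),
      interp M xs (a1, Dcons b d) & interp P xs (a2, b)]]
  | TauBar V => [set p | exists2 a, interp V xs a & p = (a, Dstar)]
  | Bag L N => bag_interp [seq interp M xs | M <- L]
                          (unions [seq interp M xs | M <- N])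
  | Tau L => test_interp [seq interp M xs | M <- L]
  end.

Definition interp_sum s (A : sums s) n (xs : n.-tuple nat) : set (point s n) :=
  unions [seq interp a xs | a <- A].

(* Main.v *)
(* The interpretation is first made independent of the list of variables: an  *)
(* expression denotes a set of pairs of an environment (a multiset of D for   *)
(* every de Bruijn index) and an output, and for a repetition-free list the   *)
(* tuple interpretation is the inverse image of this set, variables outside   *)
(* the list being mapped to the empty multiset.  Each constructor then acts   *)
(* as an operator on such sets which commutes with unions.  Linear            *)
(* substitution acts as a derivation: an environment in which the variable    *)
(* carries one more element d is replaced by one that also pays for producing *)
(* d with the substituted term; it obeys the Leibniz rule on products.        *)
(* Ordinary substitution by a sum N replaces the whole multiset carried by    *)
(* the variable by the cost of producing it with a finite multiset of uses of *)
(* N; it is multiplicative.  Substituting N after differentiating along       *)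
(* L_1, ..., L_k amounts to replacing the multiset carried by the variable by *)
(* an output of the bag [L_1, ..., L_k, N^!], which is beta.                  *)
Require Import Defs.
From mathcomp Require Import all_boot finmap multiset boolp classical_sets.
From mathcomp Require Import zify.

Set Implicit Arguments.
Unset Strict Implicit.
Unset Printing Implicit Defensive.

Local Open Scope mset_scope.
Local Open Scope classical_set_scope.

(** An expression is read as a power series with Boolean coefficients whose exponents are
    environments. [cprod] is multiplication, [bang X] is the exponential of [X], and [deriv] is a
    directional derivative. [psubst] trades the power [b] of a variable for the part of a bag with
    output [b]. [meaning_lift], [meaning_lin] and [meaning_subst] identify the syntactic operations
    with these operators.

    Beta then follows from two facts. Applying an abstraction to a bag is [psubst] of that bag in
    the body ([cprod_abst], by injectivity of [Dcons]). A derivative along [X] followed by [psubst]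
    of [B] is [psubst] of the product of [X] and [B] ([psubst_deriv0]). The rules for tests rest on
    [Dcons_star]: [Dstar] is the function that asks for nothing and returns [Dstar]. Contextual
    closure holds because every constructor is linear except promotion, whose meaning depends only
    on the union of the promoted sum. [interp_meaning] transfers the result to tuples. *)

Lemma Dcons_inj b d b' d' : Dcons b d = Dcons b' d' -> b = b' /\ d = d'.
Proof.
move=> E; split; first by rewrite -(Dseq_cons0 b d) E Dseq_cons0.
by apply: Dseq_ext => i; rewrite -(Dseq_consS b d) E Dseq_consS.
Qed.

Lemma Dcons_star : Dcons mset0 Dstar = Dstar.
Proof.
by apply: Dseq_ext => -[|i]; rewrite ?Dseq_cons0 ?Dseq_consS !Dseq_star.
Qed.

Lemma mset1_inj (K : choiceType) (c d : K) : [mset c]%mset = [mset d]%mset -> c = d.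
Proof. by move=> E; apply/mset1P; rewrite -E; apply/mset1P. Qed.

Lemma mset_add_eq0 (K : choiceType) (a b : {mset K}) :
  (a `+` b)%mset = mset0 -> a = mset0 /\ b = mset0.
Proof.
by move=> E; split; apply/msetP => x; have := congr1 (fun c : {mset K} => c x) E;
  rewrite /= msetE2 !mset0E; lia.
Qed.

(** One occurrence of [d] in a sum lies in one of the two summands. This is the combinatorial source
    of the Leibniz rule. *)
Lemma mset_cons_split (K : choiceType) (d : K) (b b1 b2 : {mset K}) :
  (d +` b = b1 `+` b2)%mset ->
  (exists2 c, b1 = (d +` c)%mset & b = (c `+` b2)%mset) \/
  (exists2 c, b2 = (d +` c)%mset & b = (b1 `+` c)%mset).
Proof.
move=> E; have := mset1D1 d b; rewrite E => /msetDP[] /msetB1K H.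
  left; exists (b1 `\ d)%mset => //; move: E; rewrite -{1}H -msetDA.
  exact: (can_inj (msetDKB _)).
right; exists (b2 `\ d)%mset => //; move: E; rewrite -{1}H msetDCA.
exact: (can_inj (msetDKB _)).
Qed.

(** * Environments *)

Definition env := nat -> {mset D}.
Definition ezero : env := fun=> mset0.
Definition eadd (f g : env) : env := fun x => (f x `+` g x)%mset.
Definition esingle (k : nat) (d : D) : env := fun x => if x == k then [mset d]%mset else mset0.
(* The environments for the scope of [lift k _]: index [k] is new.            *)
Definition einsert (k : nat) (b : {mset D}) (f : env) : env :=
  fun x => if x == k then b else f (unbump k x).

Local Notation "f +e g" := (eadd f g) (at level 50, left associativity).

Lemma eaddA f g h : f +e (g +e h) = f +e g +e h.
Proof. by apply: funext => x; rewrite /eadd msetDA. Qed.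

Lemma eaddC f g : f +e g = g +e f.
Proof. by apply: funext => x; rewrite /eadd msetDC. Qed.

Lemma eaddAC f g h : f +e g +e h = f +e h +e g.
Proof. by rewrite -eaddA (eaddC g) eaddA. Qed.

Lemma eaddCA f g h : f +e (g +e h) = g +e (f +e h).
Proof. by rewrite eaddA (eaddC f) eaddA. Qed.

Lemma eaddACA f g h i : (f +e g) +e (h +e i) = (f +e h) +e (g +e i).
Proof. by rewrite -!eaddA (eaddCA g). Qed.

Lemma eadd0 f : f +e ezero = f.
Proof. by apply: funext => x; rewrite /eadd msetD0. Qed.

Lemma e0add f : ezero +e f = f.
Proof. by rewrite eaddC eadd0. Qed.

Lemma eadd_eq0 f g : f +e g = ezero -> f = ezero /\ g = ezero.
Proof.
move=> E; have H x : f x = mset0 /\ g x = mset0.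
  by apply: mset_add_eq0; apply: (congr1 (fun h => h x) E).
by split; apply: funext => x; case: (H x).
Qed.

Lemma einsertE k b f : einsert k b f k = b.
Proof. by rewrite /einsert eqxx. Qed.

Lemma einsert_bump k b f : einsert k b f \o bump k = f.
Proof.
by apply: funext => x; rewrite /einsert /= eq_sym (negbTE (neq_bump k x)) bumpK.
Qed.

Lemma einsert_inj k b f b' f' : einsert k b f = einsert k b' f' -> b = b' /\ f = f'.
Proof.
move=> E; split; first by rewrite -(einsertE k b f) E einsertE.
by rewrite -(einsert_bump k b f) E einsert_bump.
Qed.

(** Every environment is an insertion at [k], so equations between environments can be split into
    index [k] and the rest. *)
Lemma einsertK k f : einsert k (f k) (f \o bump k) = f.
Proof.
apply: funext => x; rewrite /einsert; case: eqP => [->//|/eqP xk].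
by rewrite /= unbumpK.
Qed.

Lemma einsert_add k b f b' f' :
  einsert k b f +e einsert k b' f' = einsert k (b `+` b')%mset (f +e f').
Proof. by apply: funext => x; rewrite /eadd /einsert; case: eqP. Qed.

Lemma einsert_eq_add k b f g h : einsert k b f = g +e h ->
  [/\ g = einsert k (g k) (g \o bump k), h = einsert k (h k) (h \o bump k),
      b = (g k `+` h k)%mset & f = (g \o bump k) +e (h \o bump k)].
Proof.
move=> E; rewrite !einsertK; split=> //.
  by rewrite -(einsertE k b f) E.
by rewrite -(einsert_bump k b f) E.
Qed.

Lemma einsert0 k : einsert k mset0 ezero = ezero.
Proof. by apply: funext => x; rewrite /einsert; case: eqP. Qed.

Lemma einsert_single k d : einsert k [mset d]%mset ezero = esingle k d.
Proof. by apply: funext => x; rewrite /einsert /esingle; case: eqP. Qed.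

Lemma einsert_single_bump k x d : einsert k mset0 (esingle x d) = esingle (bump k x) d.
Proof.
apply: funext => y; rewrite /einsert /esingle; case: eqP => [->|/eqP yk].
  by rewrite (negbTE (neq_bump k x)).
by rewrite -(can_eq (bumpK k)) unbumpK.
Qed.

Lemma einsert0S b f x : einsert 0 b f x.+1 = f x.
Proof. by rewrite /einsert /unbump subn1. Qed.

Lemma einsertS k b c f : einsert 0 c (einsert k b f) = einsert k.+1 b (einsert 0 c f).
Proof.
apply: funext => -[//|x]; rewrite einsert0S [RHS]/einsert eqSS unbumpS.
by rewrite einsert0S.
Qed.

Lemma esingleS k d : einsert 0 mset0 (esingle k d) = esingle k.+1 d.
Proof. exact: einsert_single_bump. Qed.

Lemma single_split k d f g h : f +e esingle k d = g +e h ->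
  (exists2 g', g = g' +e esingle k d & f = g' +e h) \/
  (exists2 h', h = h' +e esingle k d & f = g +e h').
Proof.
rewrite -(einsertK k f) -einsert_single einsert_add eadd0 => /einsert_eq_add[gE hE].
rewrite msetDC => /mset_cons_split[][c bE ->] ->; [left|right].
  exists (einsert k c (g \o bump k)); last by rewrite {3}hE einsert_add.
  by rewrite einsert_add eadd0 msetDC -bE.
exists (einsert k c (h \o bump k)); last by rewrite {3}gE einsert_add.
by rewrite einsert_add eadd0 msetDC -bE.
Qed.

(** * Operators on sets of environment-output pairs *)

Definition out (s : kind) : Type :=
  match s with Tm => D | Bg => {mset D} | Ts => unit end.

Section Operators.
Implicit Types (k : nat) (f g : env) (O : Type).

(* Common form of application, of adding a linear component to a bag, and of  *)
(* bag union: these differ in the relation [R] between outputs.               *)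
Definition cprod O1 O2 O (R : O1 -> O2 -> O -> Prop)
    (A : set (env * O1)) (B : set (env * O2)) : set (env * O) :=
  [set p | exists f1 f2 o1 o2,
     [/\ p.1 = f1 +e f2, R o1 o2 p.2, A (f1, o1) & B (f2, o2)]].

Definition post O O' (R : O -> O' -> Prop) (A : set (env * O)) : set (env * O') :=
  [set p | exists2 o, R o p.2 & A (p.1, o)].

Definition abst (A : set (env * D)) : set (env * D) :=
  [set p | exists b d, p.2 = Dcons b d /\ A (einsert 0 b p.1, d)].

(** Semantic counterpart of [lift]: a lifted expression makes no use of index [k]. *)
Definition weaken k O (A : set (env * O)) : set (env * O) :=
  [set p | p.1 k = mset0 /\ A (p.1 \o bump k, p.2)].

(* The variable [k] stays in scope, as in [lin]; in [psubst] it disappears.   *)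
Definition deriv k (X : set (env * D)) O (A : set (env * O)) : set (env * O) :=
  [set p | exists f g d, [/\ p.1 = f +e g, X (g, d) & A (f +e esingle k d, p.2)]].

Definition psubst k (B : set (env * {mset D})) O (A : set (env * O)) : set (env * O) :=
  [set p | exists f g b, [/\ p.1 = f +e g, B (g, b) & A (einsert k b f, p.2)]].

(** Empty and binary unions suffice, since formal sums are finite. *)
Definition linear O O' (C : set (env * O) -> set (env * O')) :=
  C set0 = set0 /\ forall A B, C (A `|` B) = C A `|` C B.

Lemma linear_unions O O' (C : set (env * O) -> set (env * O')) Xs :
  linear C -> C (unions Xs) = unions [seq C X | X <- Xs].
Proof.
case=> C0 CU; rewrite /unions big_map; elim: Xs => [|X Xs IH].
  by rewrite !big_nil.
by rewrite !big_cons CU IH.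
Qed.

Lemma cprod_linearl O1 O2 O (R : O1 -> O2 -> O -> Prop) B : linear (fun A => cprod R A B).
Proof.
split; first by apply/seteqP; split=> -[f o] // [? [? [? [? []]]]].
move=> A A'; apply/seteqP; split=> -[f o].
  by case=> f1 [f2] [o1] [o2] [fE r [a|a] b]; [left|right]; exists f1, f2, o1, o2.
by case=> -[f1] [f2] [o1] [o2] [fE r a b]; exists f1, f2, o1, o2; split=> //; [left|right].
Qed.

Lemma cprod_linearr O1 O2 O (R : O1 -> O2 -> O -> Prop) A : linear (cprod R A).
Proof.
split; first by apply/seteqP; split=> -[f o] // [? [? [? [? []]]]].
move=> B B'; apply/seteqP; split=> -[f o].
  by case=> f1 [f2] [o1] [o2] [fE r a [b|b]]; [left|right]; exists f1, f2, o1, o2.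
by case=> -[f1] [f2] [o1] [o2] [fE r a b]; exists f1, f2, o1, o2; split=> //; [left|right].
Qed.

Lemma post_linear O O' (R : O -> O' -> Prop) : linear (post R).
Proof.
split; first by apply/seteqP; split=> -[f o] // [].
move=> A B; apply/seteqP; split=> -[f o].
  by case=> o' r [a|a]; [left|right]; exists o'.
by case=> -[o' r a]; exists o' => //; [left|right].
Qed.

Lemma abst_linear : linear abst.
Proof.
split; first by apply/seteqP; split=> -[f o] // [? [? []]].
move=> A B; apply/seteqP; split=> -[f o].
  by case=> b [d] [oE [a|a]]; [left|right]; exists b, d.
by case=> -[b] [d] [oE a]; exists b, d; split=> //; [left|right].
Qed.

Lemma weaken_linear k O : linear (@weaken k O).
Proof.
split; first by apply/seteqP; split=> -[f o] // [].
move=> A B; apply/seteqP; split=> -[f o].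
  by case=> fk [a|a]; [left|right].
by case=> -[fk a]; split=> //; [left|right].
Qed.

Lemma deriv_linear k X O : linear (@deriv k X O).
Proof.
split; first by apply/seteqP; split=> -[f o] // [? [? [? []]]].
move=> A B; apply/seteqP; split=> -[f o].
  by case=> f1 [f2] [d] [fE x [a|a]]; [left|right]; exists f1, f2, d.
by case=> -[f1] [f2] [d] [fE x a]; exists f1, f2, d; split=> //; [left|right].
Qed.

Lemma psubst_linear k B O : linear (@psubst k B O).
Proof.
split; first by apply/seteqP; split=> -[f o] // [? [? [? []]]].
move=> A A'; apply/seteqP; split=> -[f o].
  by case=> f1 [f2] [d] [fE x [a|a]]; [left|right]; exists f1, f2, d.
by case=> -[f1] [f2] [d] [fE x a]; exists f1, f2, d; split=> //; [left|right].
Qed.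

Definition outcons (d : D) (b' b : {mset D}) : Prop := b = (d +` b')%mset.
Definition outapp (d : D) (b : {mset D}) (d' : D) : Prop := d = Dcons b d'.
Definition outplus (b1 b2 b : {mset D}) : Prop := b = (b1 `+` b2)%mset.

Definition bag_nil : set (env * {mset D}) := [set (ezero, mset0)].
(* Outputs of [N^!] that use [N] exactly [m] times, where [X] interprets [N]. *)
Definition bag_pow (X : set (env * D)) m := iter m (cprod outcons X) bag_nil.
Definition bang (X : set (env * D)) := [set p | exists m, bag_pow X m p].

Lemma weaken_cprod k O1 O2 O (R : O1 -> O2 -> O -> Prop) A B :
  weaken k (cprod R A B) = cprod R (weaken k A) (weaken k B).
Proof.
apply/seteqP; split=> -[f o] /=.
  case=> fk [f1] [f2] [o1] [o2] /= [fE r a b].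
  exists (einsert k mset0 f1), (einsert k mset0 f2), o1, o2.
  split=> //; rewrite /weaken /= ?einsertE ?einsert_bump //.
  by rewrite einsert_add msetD0 -fE -fk einsertK.
case=> f1 [f2] [o1] [o2] /= [-> r [/= fk1 a] [/= fk2 b]].
split; first by rewrite /= /eadd fk1 fk2 msetD0.
by exists (f1 \o bump k), (f2 \o bump k), o1, o2.
Qed.

Lemma weaken_bag_nil k : weaken k bag_nil = bag_nil.
Proof.
apply/seteqP; split=> -[f b].
  by case=> /= fk [fE ->]; congr pair; rewrite -(einsertK k f) fk fE einsert0.
by case=> -> ->.
Qed.

Lemma weaken_bang k X : weaken k (bang X) = bang (weaken k X).
Proof.
have E m : weaken k (bag_pow X m) = bag_pow (weaken k X) m.
  by elim: m => [|m IH]; rewrite ?weaken_bag_nil // /bag_pow !iterS weaken_cprod; congr cprod.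
apply/seteqP; split=> -[f b].
  by case=> fk [m x]; exists m; rewrite -E.
by case=> m; rewrite -E => -[fk x]; split=> //; exists m.
Qed.

Lemma weaken_post k O O' (R : O -> O' -> Prop) A : weaken k (post R A) = post R (weaken k A).
Proof.
by apply/seteqP; split=> -[f o] [] /= => [fk [o' r a]|o' r [fk a]];
  [exists o'|split=> //; exists o'].
Qed.

Lemma weaken_abst k A : weaken k (abst A) = abst (weaken k.+1 A).
Proof.
have E b f : f k = mset0 -> einsert 0 b f \o bump k.+1 = einsert 0 b (f \o bump k).
  move=> fk; rewrite -{1}(einsertK k f) einsertS einsert_bump //.
apply/seteqP; split=> -[f o].
  case=> /= fk [b] [d] [/= -> a]; exists b, d; split=> //.
  by split; rewrite /= ?einsert0S // E.
case=> b [d] [/= -> [/= fk a]]; rewrite einsert0S in fk.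
by split=> //; exists b, d; split=> //; rewrite /= -E.
Qed.

(** * Derivation: Leibniz rule and derivative of the exponential *)

(** By [single_split], the additional element carried by [k] is consumed by exactly one of the
    factors. *)
Lemma deriv_cprod k X O1 O2 O (R : O1 -> O2 -> O -> Prop) A B :
  deriv k X (cprod R A B) = cprod R (deriv k X A) B `|` cprod R A (deriv k X B).
Proof.
apply/seteqP; split=> -[f o] /=.
  case=> g [h] [d] /= [-> x [f1] [f2] [o1] [o2] [/= /single_split[][g' E ->] r a b]].
    left; exists (g' +e h), f2, o1, o2; split=> //; first by rewrite /= eaddAC.
    by exists g', h, d; rewrite -E.
  right; exists f1, (g' +e h), o1, o2; split=> //; first by rewrite /= eaddA.
  by exists g', h, d; rewrite -E.
case=> -[f1] [f2] [o1] [o2] [/= -> r].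
  case=> g [h] [d] /= [-> x a] b; exists (g +e f2), h, d; split=> //.
    by rewrite /= eaddAC.
  by exists (g +e esingle k d), f2, o1, o2; split=> //=; rewrite eaddAC.
move=> a [g] [h] [d] /= [-> x b]; exists (f1 +e g), h, d; split=> //.
  by rewrite /= eaddA.
by exists f1, (g +e esingle k d), o1, o2; split=> //=; rewrite eaddA.
Qed.

Lemma deriv_bag_nil k X : deriv k X bag_nil = set0.
Proof.
apply/seteqP; split=> -[f b] // [g] [h] [d] [_ _ [/eadd_eq0[_]]].
move=> /(congr1 (fun f => f k)); rewrite /esingle eqxx /ezero.
by move=> /msetP/(_ d); rewrite msetnxx mset0E.
Qed.

Lemma cprod_outconsCA X Y T :
  cprod outcons X (cprod outcons Y T) = cprod outcons Y (cprod outcons X T).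
Proof.
have H X' Y' : cprod outcons X' (cprod outcons Y' T) `<=` cprod outcons Y' (cprod outcons X' T).
  move=> [f o] [f1] [f2] [d] [b'] /= [-> -> x [f3] [f4] [e] [b] /= [-> -> y t]].
  exists f3, (f1 +e f4), e, (d +` b)%mset; split=> //=.
  - by rewrite eaddCA.
  - by rewrite /outcons msetDCA.
  - by exists f1, f4, d, b.
by apply/seteqP; split; apply: H.
Qed.

Lemma cprod_bang A X :
  cprod outcons A (bang X) = [set p | exists m, cprod outcons A (bag_pow X m) p].
Proof.
apply/seteqP; split=> -[f o].
  by case=> f1 [f2] [d] [b] [fE r a [m x]]; exists m; exists f1, f2, d, b.
by case=> m [f1] [f2] [d] [b] [fE r a x]; exists f1, f2, d, b; split=> //; exists m.
Qed.

(** The rule for the derivative of a power; its factor [m + 1] disappears because union is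
    idempotent. *)
Lemma deriv_bag_pow k X Y m :
  deriv k X (bag_pow Y m.+1) = cprod outcons (deriv k X Y) (bag_pow Y m).
Proof.
elim: m => [|m IH]; rewrite /bag_pow iterS deriv_cprod.
  by rewrite deriv_bag_nil (cprod_linearr _ _).1 setU0.
by rewrite -/(bag_pow Y m.+1) IH cprod_outconsCA setUid.
Qed.

(** The exponential rule: this is why linear substitution in a promoted sum extracts one linear copy
    and keeps the promotion. *)
Lemma deriv_bang k X Y : deriv k X (bang Y) = cprod outcons (deriv k X Y) (bang Y).
Proof.
have E : deriv k X (bang Y) = [set p | exists m, deriv k X (bag_pow Y m) p].
  apply/seteqP; split=> -[f o].
    by case=> f1 [f2] [d] [fE x [m y]]; exists m; exists f1, f2, d.
  by case=> m [f1] [f2] [d] [fE x y]; exists f1, f2, d; split=> //; exists m.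
rewrite E cprod_bang; apply/seteqP; split=> -[f o] [m].
  (* The power 0 is constant and contributes nothing; the power [m + 1] yields the power [m]. *)
  case: m => [|m]; first by rewrite deriv_bag_nil.
  by rewrite deriv_bag_pow => h; exists m.
by move=> h; exists m.+1; rewrite deriv_bag_pow.
Qed.

Lemma deriv_post k X O O' (R : O -> O' -> Prop) A :
  deriv k X (post R A) = post R (deriv k X A).
Proof.
apply/seteqP; split=> -[f o].
  by case=> f1 [f2] [d] [fE x [o' r a]]; exists o' => //; exists f1, f2, d.
by case=> o' r [f1] [f2] [d] [fE x a]; exists f1, f2, d; split=> //; exists o'.
Qed.

Lemma deriv_abst k X A : deriv k X (abst A) = abst (deriv k.+1 (weaken 0 X) A).
Proof.
apply/seteqP; split=> -[f o] /=.
  case=> g [h] [e] /= [-> x] [b] [d] [/= -> a]; exists b, d; split=> //.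
  exists (einsert 0 b g), (einsert 0 mset0 h), e; split=> //=.
  - by rewrite einsert_add msetD0.
  - by split; rewrite //= einsert_bump.
  - by rewrite -esingleS einsert_add msetD0.
case=> b [d] [/= -> [g] [h] [e] [/= /einsert_eq_add[gE hE bE ->] [/= h0 x] a]].
exists (g \o bump 0), (h \o bump 0), e; split=> //; exists b, d; split=> //=.
by move: a; rewrite {1}gE -esingleS einsert_add bE h0 msetD0.
Qed.

(** * Substitution of a promoted sum *)

(** Each element of the output is paid for by its own use of [X], so the cost divides along any
    division of the output. With [bag_pow_plus] this makes [psubst] of a [bang] multiplicative. *)
Lemma bag_pow_split X m f b1 b2 : bag_pow X m (f, (b1 `+` b2)%mset) ->
  exists f1 f2, [/\ f = f1 +e f2, bang X (f1, b1) & bang X (f2, b2)].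
Proof.
elim: m f b1 b2 => [|m IH] f b1 b2.
  case=> -> /mset_add_eq0[-> ->]; exists ezero, ezero.
  by split; [rewrite eadd0|exists 0|exists 0].
case=> f1 [f2] [d] [b] [/= -> /esym/mset_cons_split[][c -> ->] x /IH[g1] [g2] [-> [m1 y1] [m2 y2]]].
  exists (f1 +e g1), g2; split; [by rewrite eaddA| |by exists m2].
  by exists m1.+1, f1, g1, d, c.
exists g1, (f1 +e g2); split; [by rewrite eaddCA|by exists m1|].
by exists m2.+1, f1, g2, d, c.
Qed.

Lemma bag_pow_plus X m f1 f2 b1 b2 : bag_pow X m (f1, b1) -> bang X (f2, b2) ->
  bang X (f1 +e f2, (b1 `+` b2)%mset).
Proof.
elim: m f1 b1 => [|m IH] f1 b1; first by case=> -> ->; rewrite e0add mset0D.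
case=> g1 [g2] [d] [b] [/= -> -> x y] z; have [n h] := IH _ _ y z.
by exists n.+1, g1, (g2 +e f2), d, (b `+` b2)%mset; split=> //=;
  rewrite /outcons ?eaddA ?msetDA.
Qed.

Lemma psubst_cprod k X O1 O2 O (R : O1 -> O2 -> O -> Prop) A B :
  psubst k (bang X) (cprod R A B) = cprod R (psubst k (bang X) A) (psubst k (bang X) B).
Proof.
apply/seteqP; split=> -[f o].
  case=> g [h] [b] [/= -> [m x]] [g1] [g2] [o1] [o2] [/= /einsert_eq_add[E1 E2 bE ->] r a1 a2].
  move: x; rewrite bE => /bag_pow_split[h1] [h2] [-> x1 x2].
  exists ((g1 \o bump k) +e h1), ((g2 \o bump k) +e h2), o1, o2; split=> //=.
  - by rewrite eaddACA.
  - by exists (g1 \o bump k), h1, (g1 k); split=> //; rewrite einsertK.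
  - by exists (g2 \o bump k), h2, (g2 k); split=> //; rewrite einsertK.
case=> f1 [f2] [o1] [o2] [/= -> r [g1] [h1] [b1] /= [-> [m x1] a1] [g2] [h2] [b2] /= [-> x2 a2]].
exists (g1 +e g2), (h1 +e h2), (b1 `+` b2)%mset; split=> /=.
- by rewrite eaddACA.
- exact: bag_pow_plus x1 x2.
- by exists (einsert k b1 g1), (einsert k b2 g2), o1, o2; split=> //=; rewrite einsert_add.
Qed.

Lemma bang0 X f : bang X (f, mset0) <-> f = ezero.
Proof.
split=> [[[[]//|m]]|->]; last by exists 0.
by case=> f1 [f2] [d] [b] [_ /esym/mset_add_eq0[/msetP/(_ d)]]; rewrite msetnxx mset0E.
Qed.

Lemma bang1 X f d : bang X (f, [mset d]%mset) <-> X (f, d).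
Proof.
split=> [[[[_ /msetP/(_ d)]|m]]|x]; first by rewrite msetnxx mset0E.
  case=> f1 [f2] [e] [b] [/= -> E x y].
  have /mset_cons_split[] : (d +` mset0 = e +` b)%mset by rewrite msetD0.
    move=> [c E1 /esym/mset_add_eq0[c0 b0]]; move: E1; rewrite c0 msetD0 => /mset1_inj <-.
    by have /(bang0 X)-> : bang X (f2, mset0); [rewrite -b0; exists m|rewrite eadd0].
  move=> [c _ /esym/mset_add_eq0[e0 _]].
  by move/msetP/(_ e): e0; rewrite msetnxx mset0E.
by exists 1, f, ezero, d, mset0; split; rewrite ?eadd0 // /outcons msetD0.
Qed.

Lemma psubst_bag_nil k X : psubst k (bang X) bag_nil = bag_nil.
Proof.
apply/seteqP; split=> -[f b].
  case=> g [h] [b'] [/= -> x []]; rewrite -(einsert0 k) => /einsert_inj[b0 -> ->].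
  by move: x; rewrite b0 => /bang0 ->; rewrite eadd0.
case=> -> ->; exists ezero, ezero, mset0; split; rewrite /= ?eadd0 ?einsert0 //.
exact/bang0.
Qed.

Lemma psubst_bang k X Y : psubst k (bang X) (bang Y) = bang (psubst k (bang X) Y).
Proof.
have E m : psubst k (bang X) (bag_pow Y m) = bag_pow (psubst k (bang X) Y) m.
  by elim: m => [|m IH]; rewrite ?psubst_bag_nil // /bag_pow !iterS psubst_cprod; congr cprod.
apply/seteqP; split=> -[f b].
  case=> g [h] [c] [fE x [m y]]; exists m; rewrite -E; by exists g, h, c.
by case=> m; rewrite -E => -[g] [h] [c] [fE x y]; exists g, h, c; split=> //; exists m.
Qed.

Lemma psubst_post k B O O' (R : O -> O' -> Prop) A :
  psubst k B (post R A) = post R (psubst k B A).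
Proof.
apply/seteqP; split=> -[f o].
  by case=> f1 [f2] [d] [fE x [o' r a]]; exists o' => //; exists f1, f2, d.
by case=> o' r [f1] [f2] [d] [fE x a]; exists f1, f2, d; split=> //; exists o'.
Qed.

Lemma psubst_abst k B A : psubst k B (abst A) = abst (psubst k.+1 (weaken 0 B) A).
Proof.
apply/seteqP; split=> -[f o] /=.
  case=> g [h] [c] /= [-> x] [b] [d] [/= -> a]; exists b, d; split=> //.
  exists (einsert 0 b g), (einsert 0 mset0 h), c; split=> //=.
  - by rewrite einsert_add msetD0.
  - by split; rewrite //= einsert_bump.
  - by rewrite -einsertS.
case=> b [d] [/= -> [g] [h] [c] [/= /einsert_eq_add[gE hE bE ->] [/= h0 x] a]].
exists (g \o bump 0), (h \o bump 0), c; split=> //; exists b, d; split=> //=.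
by move: a; rewrite einsertS bE h0 msetD0 einsertK.
Qed.

(** Both sides charge index 0 for the elements of [B] and for one further element paid by [X]. [X]
    is weakened because it lives outside the scope of index 0. *)
Lemma psubst_deriv0 B X O (A : set (env * O)) :
  psubst 0 B (deriv 0 (weaken 0 X) A) = psubst 0 (cprod outcons X B) A.
Proof.
apply/seteqP; split=> -[f o].
  case=> g [h] [b] [/= -> x] [g1] [h1] [d] [/= /einsert_eq_add[gE hE bE ->] [/= h0 y] a].
  exists (g1 \o bump 0), ((h1 \o bump 0) +e h), (d +` b)%mset; split=> /=.
  - by rewrite eaddA.
  - by exists (h1 \o bump 0), h, d, b.
  - by move: a; rewrite {1}gE bE h0 msetD0 -einsert_single einsert_add eadd0 msetDC.
case=> g [h] [b] [/= -> [h1] [h2] [d] [b'] /= [-> -> x y] a].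
exists (g +e h1), h2, b'; split=> //=; first by rewrite eaddA.
exists (einsert 0 b' g), (einsert 0 mset0 h1), d; split=> /=.
- by rewrite einsert_add msetD0.
- by split; rewrite //= einsert_bump.
- by move: a; rewrite -einsert_single einsert_add eadd0 msetDC.
Qed.

End Operators.

(** * Interpretation of expressions *)

Definition outstar (_ : unit) (d : D) : Prop := d = Dstar.
(* A test is interpreted like the bag of its components, all outputs of which *)
(* must be [Dstar].                                                           *)
Definition allstar (b : {mset D}) (_ : unit) : Prop := forall d, d \in b -> d = Dstar.

Definition bagm (Xs : seq (set (env * D))) T := foldr (cprod outcons) T Xs.

Fixpoint meaning s (e : expr s) : set (env * out s) :=
  match e in expr s return set (env * out s) with
  | Var x => [set p : env * D | p.1 = esingle x p.2]
  | Lam M => abst (meaning M)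
  | App M P => cprod outapp (meaning M) (meaning P)
  | TauBar V => post outstar (meaning V)
  | Bag L N => bagm [seq meaning M | M <- L] (bang (unions [seq meaning M | M <- N]))
  | Tau L => post allstar (bagm [seq meaning M | M <- L] bag_nil)
  end.

Definition means s (A : sums s) : set (env * out s) := unions [seq meaning a | a <- A].

Section ExprInd.
Variable P : forall s, expr s -> Prop.

(** Gives induction hypotheses for the terms inside the lists of bags and tests. *)
Definition all_tm (L : seq (expr Tm)) : Prop := foldr (fun M Q => P M /\ Q) True L.

Hypothesis HVar : forall x, P (Var x).
Hypothesis HLam : forall M, P M -> P (Lam M).
Hypothesis HApp : forall M Q, P M -> P Q -> P (App M Q).
Hypothesis HTauBar : forall V, P V -> P (TauBar V).
Hypothesis HBag : forall L N, all_tm L -> all_tm N -> P (Bag L N).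
Hypothesis HTau : forall L, all_tm L -> P (Tau L).

Fixpoint expr_ind_nested s (e : expr s) : P e :=
  let all_tmP := fix all_tmP L : all_tm L :=
    if L is M :: L' return all_tm L then conj (expr_ind_nested M) (all_tmP L') else I in
  match e with
  | Var x => HVar x
  | Lam M => HLam (expr_ind_nested M)
  | App M Q => HApp (expr_ind_nested M) (expr_ind_nested Q)
  | TauBar V => HTauBar (expr_ind_nested V)
  | Bag L N => HBag (all_tmP L) (all_tmP N)
  | Tau L => HTau (all_tmP L)
  end.

End ExprInd.

Lemma map_all_tm (T : Type) (f g : expr Tm -> T) (P : forall s, expr s -> Prop) L :
  (forall M, P Tm M -> f M = g M) -> all_tm P L -> map f L = map g L.
Proof. by move=> fg; elim: L => //= M L IH [/fg-> /IH->]. Qed.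

(** * Sums and unions *)

Lemma unions_nil T : unions [::] = set0 :> set T.
Proof. by rewrite /unions big_nil. Qed.

Lemma unions_cons T (X : set T) Xs : unions (X :: Xs) = X `|` unions Xs.
Proof. by rewrite /unions big_cons. Qed.

Lemma unions_cat T (Xs Ys : seq (set T)) : unions (Xs ++ Ys) = unions Xs `|` unions Ys.
Proof. by rewrite /unions big_cat. Qed.

Lemma unions_flatten T (Xss : seq (seq (set T))) :
  unions (flatten Xss) = unions [seq unions Xs | Xs <- Xss].
Proof.
by elim: Xss => [|Xs Xss IH] /=; rewrite ?unions_nil // unions_cat unions_cons IH.
Qed.

Lemma means_flatten s (As : seq (sums s)) : means (flatten As) = unions [seq means A | A <- As].
Proof. by rewrite /means map_flatten unions_flatten -map_comp. Qed.

Lemma means_cat s (A B : sums s) : means (A ++ B) = means A `|` means B.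
Proof. by rewrite /means map_cat unions_cat. Qed.

Lemma means_cons s (a : expr s) A : means (a :: A) = meaning a `|` means A.
Proof. exact: unions_cons. Qed.

Lemma means_nil s : means [::] = set0 :> set (env * out s).
Proof. exact: unions_nil. Qed.

Lemma means_seq1 s (a : expr s) : means [:: a] = meaning a.
Proof. by rewrite means_cons means_nil setU0. Qed.

Lemma means_map s s' (c : expr s -> expr s') C A : linear C ->
  (forall a, meaning (c a) = C (meaning a)) -> means (map c A) = C (means A).
Proof.
move=> linC cC; rewrite /means (linear_unions _ linC) -!map_comp.
by congr unions; apply: eq_map.
Qed.
Arguments means_map {s s'} c {C} A _ _.

Lemma means_allpairs s1 s2 s (c : expr s1 -> expr s2 -> expr s) C A B :
  (forall X, linear (C^~ X)) -> (forall X, linear (C X)) ->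
  (forall a b, meaning (c a b) = C (meaning a) (meaning b)) ->
  means [seq c a b | a <- A, b <- B] = C (means A) (means B).
Proof.
move=> linl linr cC; rewrite means_flatten /means (linear_unions _ (linl _)) -!map_comp.
congr unions; apply: eq_map => a /=; exact: (means_map (c a) _ (linr _)).
Qed.
Arguments means_allpairs {s1 s2 s} c {C} A B _ _ _.

Lemma linear_comp O1 O2 O3 (C : set (env * O2) -> set (env * O3))
    (C' : set (env * O1) -> set (env * O2)) : linear C -> linear C' -> linear (C \o C').
Proof. by case=> C0 CU [C0' CU']; split=> [|A B] /=; rewrite ?C0' ?CU' ?C0 ?CU. Qed.

Lemma bagm_linear Xs : linear (bagm Xs).
Proof.
elim: Xs => [|X Xs IH]; first by split.
exact: linear_comp (cprod_linearr _ _) IH.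
Qed.

Lemma bagm_cons_linear Xs T : linear (fun X => bagm Xs (cprod outcons X T)).
Proof. exact: linear_comp (bagm_linear Xs) (cprod_linearl _ T). Qed.

Lemma bagm_rcons Xs X T : bagm (rcons Xs X) T = bagm Xs (cprod outcons X T).
Proof. by rewrite /bagm foldr_rcons. Qed.

Lemma weaken_bagm k Xs T : weaken k (bagm Xs T) = bagm (map (@weaken k D) Xs) (weaken k T).
Proof. by elim: Xs => //= X Xs IH; rewrite weaken_cprod IH. Qed.

Lemma psubst_bagm k X Xs T :
  psubst k (bang X) (bagm Xs T) = bagm (map (@psubst k (bang X) D) Xs) (psubst k (bang X) T).
Proof. by elim: Xs => //= Y Xs IH; rewrite psubst_cprod IH. Qed.

(** * Meaning of lifting, substitution and linear substitution *)

Lemma weaken_var k x : weaken k (meaning (Var x)) = meaning (Var (bump k x)).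
Proof.
apply/seteqP; split=> -[f d] /=; rewrite -einsert_single_bump.
  by case=> /= f0 E; rewrite -(einsertK k f) f0 E.
by move->; split; rewrite /= ?einsertE ?einsert_bump.
Qed.

Lemma meaning_lift k s (e : expr s) : meaning (Defs.lift k e) = weaken k (meaning e).
Proof.
elim/expr_ind_nested: s / e k => /= [x|M IH|M P IHM IHP|V IH|L N IHL IHN|L IHL] k.
- exact: esym (weaken_var k x).
- by rewrite IH weaken_abst.
- by rewrite IHM IHP weaken_cprod.
- by rewrite IH weaken_post.
- rewrite weaken_bagm weaken_bang (linear_unions _ (weaken_linear k D)) -!map_comp.
  congr (bagm _ (bang (unions _))).
    exact: (map_all_tm (fun M (H : forall k, _) => H k) IHL).
  exact: (map_all_tm (fun M (H : forall k, _) => H k) IHN).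
- rewrite weaken_post weaken_bagm weaken_bag_nil -!map_comp; congr (post _ (bagm _ _)).
  exact: (map_all_tm (fun M (H : forall k, _) => H k) IHL).
Qed.

Lemma means_lift k s (A : sums s) : means (map (@Defs.lift k s) A) = weaken k (means A).
Proof. exact: (means_map _ _ (weaken_linear k _) (@meaning_lift k s)). Qed.

(** A product of sums expands over all choices of one summand per factor. *)
Lemma unions_multilin Ss T :
  unions [seq bagm (map (@meaning Tm) L) T | L <- multilin Ss] = bagm (map (@means Tm) Ss) T.
Proof.
elim: Ss => [|S Ss IH] /=; first by rewrite unions_cons unions_nil setU0.
rewrite -IH /means (linear_unions _ (cprod_linearl _ _)) map_flatten unions_flatten -!map_comp.
congr unions; apply: eq_map => M /=.
by rewrite (linear_unions _ (cprod_linearr _ _)) -!map_comp; congr unions; apply: eq_map.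
Qed.

Lemma psubst_var_eq k X : psubst k (bang X) (meaning (Var k)) = X.
Proof.
apply/seteqP; split=> -[f d].
  case=> g [h] [b] [/= -> x]; rewrite -einsert_single => /einsert_inj[bE ->].
  by rewrite e0add; apply/bang1; rewrite -bE.
move=> x; exists ezero, f, [mset d]%mset; split; rewrite /= ?e0add ?einsert_single //.
exact/bang1.
Qed.

Lemma psubst_var_neq k x X : x != k ->
  psubst k (bang X) (meaning (Var x)) = meaning (Var (unbump k x)).
Proof.
move=> xk; have E d : esingle x d = einsert k mset0 (esingle (unbump k x) d).
  by rewrite einsert_single_bump unbumpK.
apply/seteqP; split=> -[f d] /=.
  case=> g [h] [b] [/= -> y]; rewrite E => /einsert_inj[bE ->].
  by move: y; rewrite bE => /bang0 ->; rewrite eadd0.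
move->; exists (esingle (unbump k x) d), ezero, mset0.
by split; rewrite /= ?eadd0 ?E //; apply/bang0.
Qed.

Lemma meaning_subst k N s (e : expr s) :
  means (subst k N e) = psubst k (bang (means N)) (meaning e).
Proof.
elim/expr_ind_nested: s / e k N => /= [x|M IH|M P IHM IHP|V IH|L B IHL IHB|L IHL] k N.
- case: eqVneq => [->|xk]; first by rewrite (psubst_var_eq k).
  by rewrite means_seq1 -(psubst_var_neq (means N) xk).
- by rewrite (means_map Lam _ abst_linear) // IH psubst_abst weaken_bang means_lift.
- rewrite (means_allpairs App (C := cprod outapp) _ _ (cprod_linearl _) (cprod_linearr _)) //.
  by rewrite IHM IHP psubst_cprod.
- by rewrite (means_map TauBar _ (post_linear outstar)) // IH psubst_post.
- rewrite psubst_bagm psubst_bang (linear_unions _ (psubst_linear k _ D)) -!map_comp.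
  rewrite -(map_all_tm (f := @means Tm \o @subst k N Tm) (fun M (H : forall k N, _) => H k N) IHL).
  rewrite -(map_all_tm (f := @means Tm \o @subst k N Tm) (fun M (H : forall k N, _) => H k N) IHB).
  rewrite map_comp -unions_multilin /means -map_comp; congr unions; apply: eq_map => L' /=.
  by have := means_flatten [seq subst k N M | M <- B]; rewrite -map_comp /means => ->.
- rewrite psubst_post psubst_bagm psubst_bag_nil -!map_comp.
  rewrite -(map_all_tm (f := @means Tm \o @subst k N Tm) (fun M (H : forall k N, _) => H k N) IHL).
  rewrite map_comp -unions_multilin /means (linear_unions _ (post_linear _)) -!map_comp.
  by congr unions.
Qed.

(** Iterated Leibniz rule: [one_at] lists the choices of the factor to be differentiated, and the
    last member differentiates the tail. The hypothesis is a family over all kinds, trivial outside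
    [Tm], to fit [all_tm]. *)
Lemma deriv_bagm k X (g : expr Tm -> sums Tm) L T :
  all_tm (fun s => if s is Tm then fun M => deriv k X (meaning M) = means (g M)
                   else fun=> True) L ->
  deriv k X (bagm (map (@meaning Tm) L) T) =
  unions [seq bagm (map (@meaning Tm) L') T | L' <- one_at g L]
  `|` bagm (map (@meaning Tm) L) (deriv k X T).
Proof.
elim: L => [_|M L IH /= [HM /IH HL]] /=; first by rewrite unions_nil set0U.
rewrite deriv_cprod HM HL (cprod_linearr _ _).2 setUA map_cat unions_cat -!map_comp.
congr (_ `|` _ `|` _).
  by rewrite /means (linear_unions _ (cprod_linearl _ _)) -!map_comp.
by rewrite (linear_unions _ (cprod_linearr _ _)) -!map_comp.
Qed.

Lemma single_inv k d e f : f +e esingle k d = esingle k e -> f = ezero /\ d = e.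
Proof.
rewrite -!einsert_single -{1}(einsertK k f) einsert_add => /einsert_inj[E0 E].
have de : d = e.
  by apply/mset1P; rewrite -E0 in_msetD; apply/orP; right; apply/mset1P.
have [f0 _] := eadd_eq0 E.
have fk : f k = mset0 by apply: (can_inj (msetDKBC [mset d]%mset)); rewrite /= E0 de mset0D.
by rewrite -(einsertK k f) fk f0 einsert0.
Qed.

Lemma deriv_var_eq k X : deriv k X (meaning (Var k)) = X.
Proof.
apply/seteqP; split=> -[f d].
  by case=> g [h] [e] [/= -> x /single_inv[-> <-]]; rewrite e0add.
by move=> x; exists ezero, f, d; rewrite /= !e0add.
Qed.

Lemma deriv_var_neq k x X : x != k -> deriv k X (meaning (Var x)) = set0.
Proof.
move=> xk; apply/seteqP; split=> -[f d] // [g] [h] [e] [/= _ _].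
move=> /(congr1 (fun f => f k)); rewrite /eadd /esingle eqxx eq_sym (negbTE xk).
by move=> /mset_add_eq0[_ /msetP/(_ e)]; rewrite msetnxx mset0E.
Qed.

Lemma meaning_lin k N s (e : expr s) :
  means (lin k N e) = deriv k (meaning N) (meaning e).
Proof.
elim/expr_ind_nested: s / e k N => /= [x|M IH|M P IHM IHP|V IH|L B IHL IHB|L IHL] k N.
- case: eqVneq => [->|xk]; first by rewrite means_seq1 (deriv_var_eq k).
  by rewrite means_nil -(deriv_var_neq (meaning N) xk).
- by rewrite (means_map Lam _ abst_linear) // IH deriv_abst meaning_lift.
- rewrite deriv_cprod -IHM -IHP means_cat.
  by rewrite (means_map (App^~ P) _ (cprod_linearl outapp (meaning P))) //
    (means_map (App M) _ (cprod_linearr outapp (meaning M))).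
- by rewrite (means_map TauBar _ (post_linear outstar)) // IH deriv_post.
- rewrite (deriv_bagm (g := @lin k N Tm)); last first.
    by elim: L IHL => //= M L IH [HM /IH HL]; split; rewrite ?HM.
  rewrite means_cat {1}/means -map_comp; congr (_ `|` _).
  rewrite deriv_bang (means_map (fun M' => Bag (rcons L M') B) _
    (bagm_cons_linear (map (@meaning Tm) L) (bang (means B)))); last first.
    by move=> M /=; rewrite map_rcons bagm_rcons.
  congr (bagm _ (cprod _ _ _)).
  rewrite means_flatten (linear_unions _ (deriv_linear _ _ _)) -!map_comp; congr unions.
  exact: (map_all_tm (fun M (H : forall k N, _) => H k N) IHB).
- rewrite deriv_post (deriv_bagm (g := @lin k N Tm)); last first.
    by elim: L IHL => //= M L IH [HM /IH HL]; split; rewrite ?HM.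
  rewrite deriv_bag_nil (bagm_linear _).1 setU0 (linear_unions _ (post_linear _)).
  by rewrite /means -!map_comp.
Qed.

(** Each round of linear substitution is absorbed into the bag by [psubst_deriv0]; the starting sum
    is arbitrary for the induction. *)
Lemma psubst_lin_bag B L (S : sums Tm) :
  psubst 0 B (means (foldl (fun S N => flatten [seq lin 0 (Defs.lift 0 N) M' | M' <- S]) S L)) =
  psubst 0 (bagm (map (@meaning Tm) L) B) (means S).
Proof.
elim: L S => //= N L IH S; rewrite IH -psubst_deriv0 -(meaning_lift 0 N) means_flatten.
rewrite {2}/means (linear_unions _ (deriv_linear _ _ _)) -!map_comp; congr (psubst _ _ (unions _)).
by apply: eq_map => M /=; rewrite meaning_lin.
Qed.

Lemma means_psubst k N S : means (flatten [seq subst k N M | M : expr Tm <- S]) =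
  psubst k (bang (means N)) (means S).
Proof.
rewrite means_flatten {2}/means (linear_unions _ (psubst_linear _ _ _)) -!map_comp.
by congr unions; apply: eq_map => M /=; rewrite meaning_subst.
Qed.

(** * Soundness of the reduction rules *)

Lemma cprod_abst A P : cprod outapp (abst A) P = psubst 0 P A.
Proof.
apply/seteqP; split=> -[f d].
  by case=> g [h] [e] [b] [/= -> -> [b'] [d'] [/= /Dcons_inj[<- <-] a] p]; exists g, h, b.
case=> g [h] [b] [/= -> p a]; exists g, h, (Dcons b d), b; split=> //.
by exists b, d.
Qed.

(** The promotion of 0 is the empty bag; needed where the test rule substitutes 0. *)
Lemma bang_set0 : bang set0 = bag_nil.
Proof.
apply/seteqP; split=> -[f b]; last by move=> ?; exists 0.
by case=> -[//|m]; rewrite /bag_pow iterS (cprod_linearl _ _).1.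
Qed.

Lemma psubst_nil k O (A : set (env * O)) :
  psubst k bag_nil A = [set p | A (einsert k mset0 p.1, p.2)].
Proof.
apply/seteqP; split=> -[f o] /=; first by case=> g [h] [b] [/= -> [-> ->]]; rewrite eadd0.
by move=> a; exists f, ezero, mset0; rewrite /= eadd0.
Qed.

Lemma bagm_cat Xs Ys T : bagm (Xs ++ Ys) T = cprod outplus (bagm Xs bag_nil) (bagm Ys T).
Proof.
elim: Xs => [|X Xs IH] /=.
  apply/seteqP; split=> -[f b].
    by move=> y; exists ezero, f, mset0, b; split; rewrite /= ?e0add // /outplus mset0D.
  by case=> f1 [f2] [b1] [b2] [/= -> -> [-> ->]]; rewrite e0add mset0D.
rewrite IH; apply/seteqP; split=> -[f b].
  case=> f1 [f2] [d] [b'] [/= -> -> x [f3] [f4] [b3] [b4] [/= -> -> y z]].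
  exists (f1 +e f3), f4, (d +` b3)%mset, b4; split=> //=.
  - by rewrite eaddA.
  - by rewrite /outplus msetDA.
  - by exists f1, f3, d, b3.
case=> f3 [f4] [b3] [b4] [/= -> -> [f1] [f5] [d] [b5] [/= -> -> x y] z].
exists f1, (f5 +e f4), d, (b5 `+` b4)%mset; split=> //=.
- by rewrite eaddA.
- by rewrite /outcons msetDA.
- by exists f5, f4, b5, b4.
Qed.

Lemma allstarD b b' : allstar (b `+` b')%mset tt <-> allstar b tt /\ allstar b' tt.
Proof.
split=> [H|[H H'] d /msetDP[]]; [|exact: H|exact: H'].
by split=> d db; apply: H; apply/msetDP; [left|right].
Qed.

Lemma allstar1 d : allstar [mset d]%mset tt <-> d = Dstar.
Proof.
split=> [H|-> e]; first by apply: H; apply/mset1P.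
by move/mset1P.
Qed.

Lemma Dcons_eq_star b d : Dcons b d = Dstar -> b = mset0 /\ d = Dstar.
Proof. by rewrite -{1}Dcons_star => /Dcons_inj. Qed.

Lemma means_tau_cons L S : means [seq Tau (M :: L) | M <- S] =
  post allstar (cprod outcons (means S) (bagm (map (@meaning Tm) L) bag_nil)).
Proof.
pose C X := post allstar (cprod outcons X (bagm (map (@meaning Tm) L) bag_nil)).
rewrite (means_map (fun M => Tau (M :: L)) (C := C)) //.
exact: linear_comp (post_linear _) (cprod_linearl _ _).
Qed.

Lemma red_sound s (e : expr s) S : red e S -> meaning e = means S.
Proof.
elim=> {s e S} /=.
- move=> M L N; rewrite means_psubst psubst_lin_bag means_seq1 cprod_abst //.
- move=> V N; rewrite means_seq1 /=; apply/seteqP; split=> -[f d].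
    case=> f1 [f2] [e] [b] [/= -> -> [[] /= /Dcons_eq_star[-> ->] v] /bang0->].
    by rewrite eadd0; exists tt.
  (* [Dstar] is read as [Dcons mset0 Dstar], so it can be applied to the empty output of the
     promotion. *)
  case=> -[] /= -> v; exists f, ezero, Dstar, mset0; split=> //=.
  + by rewrite eadd0.
  + by rewrite /outapp Dcons_star.
  + by exists tt.
  + exact/bang0.
- move=> V M L N; rewrite means_nil; apply/seteqP; split=> -[f d] //.
  (* [Dstar] accepts only the empty multiset, but a bag with a linear component outputs at least one
     element. *)
  case=> f1 [f2] [e] [b] [/= _ -> [_ /= /Dcons_eq_star[-> _] _]].
  case=> [g1] [g2] [d1] [b1] [/= _ /esym/mset_add_eq0[/msetP/(_ d1)]].
  by rewrite msetnxx mset0E.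
- move=> M L; rewrite means_tau_cons.
  rewrite meaning_subst means_nil bang_set0 psubst_nil.
  (* The test forces the abstraction to output [Dstar], that is [Dcons mset0 Dstar]: its variable
     receives nothing, as in substitution by 0. *)
  apply/seteqP; split=> -[f []] [b /= bs] [f1] [f2] [d] [b'] [/= -> bE].
    case=> c [d'] [/= dE m] l; exists b => //; exists f1, f2, d, b'; split=> //=.
    move: bs; rewrite bE => /allstarD[/allstar1 ds _]; move: ds m.
    by rewrite dE => /Dcons_eq_star[-> ->]; rewrite Dcons_star.
  move=> m l; exists b => //; exists f1, f2, d, b'; split=> //=.
  move: bs; rewrite bE => /allstarD[/allstar1 ds] _.
  by exists mset0, d; rewrite ds Dcons_star -ds.
- move=> L L'; rewrite means_seq1 /= map_cat bagm_cat.
  (* [TauBar (Tau L)] outputs a single [Dstar] where [L] outputs any number of them; [allstar] does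
     not see the difference. *)
  apply/seteqP; split=> -[f []] [b /= bs] [f1] [f2].
    case=> [d] [b'] [/= -> bE [[] /= ds [c cs l]] l'].
    move: bs; rewrite bE => /allstarD[_ bs'].
    by exists (c `+` b')%mset; [apply/allstarD|exists f1, f2, c, b'].
  case=> [c] [b'] [/= -> bE l l']; move: bs; rewrite bE => /allstarD[cs bs'].
  exists (Dstar +` b')%mset; first by apply/allstarD; split=> //; apply/allstar1.
  by exists f1, f2, Dstar, b'; split=> //; exists tt => //; exists c.
- by move=> M MM _ ->; rewrite (means_map Lam _ abst_linear).
- by move=> M P MM _ ->; rewrite (means_map (App^~ P) _ (cprod_linearl outapp (meaning P))).
- by move=> M P PP _ ->; rewrite (means_map (App M) _ (cprod_linearr outapp (meaning M))).
- by move=> V VV _ ->; rewrite (means_map TauBar _ (post_linear outstar)).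
- move=> M L N MM _ ->.
  by rewrite (means_map (fun M' => Bag (M' :: L) N) _
    (cprod_linearl outcons (meaning (Bag L N)))).
- by move=> M L N MM _ ME; rewrite means_seq1 /= map_cat unions_cons unions_cat ME.
- by move=> M L MM _ ->; rewrite means_tau_cons.
Qed.

(** * Invariance under the choice of lists representing multisets and sums *)

Lemma bagm_perm L L' T : Permutation.Permutation L L' ->
  bagm (map (@meaning Tm) L) T = bagm (map (@meaning Tm) L') T.
Proof.
elim=> {L L'} //= [M L L' _ ->|M M' L|L1 L2 L3 _ -> _ ->] //.
exact: cprod_outconsCA.
Qed.

Lemma means_In s (A : sums s) p : means A p <-> exists2 a, List.In a A & meaning a p.
Proof.
elim: A => [|a A IH]; first by rewrite means_nil; split=> // -[].
rewrite means_cons; split.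
  case=> [ap|/IH[b bA bp]]; first by exists a => //; left.
  by exists b => //; right.
case=> b [->|bA] bp; [by left|right; apply/IH; by exists b].
Qed.

Lemma eqv_meaning s (e e' : expr s) : eqv e e' -> meaning e = meaning e'.
Proof.
(* Recursion on the derivation itself reaches the equivalences nested under [Forall2] and
   [sub_sum]. *)
move: s e e'; fix IH 4 => s e e'; case=> {s e e'} //=.
- by move=> M M' /IH->.
- by move=> M M' P P' /IH-> /IH->.
- by move=> V V' /IH->.
- move=> L L1 L' N N' pL F NN' N'N; rewrite (bagm_perm _ pL).
  have -> : map (@meaning Tm) L1 = map (@meaning Tm) L'.
    by elim: F => //= M M' K K' /IH-> _ ->.
  congr (bagm _ (bang _)); apply/seteqP; split=> p /(@means_In Tm)[M ML Mp];
    apply/(@means_In Tm).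
    by case: (NN' M ML) => M' ? /IH E; exists M'; rewrite -?E.
  by case: (N'N M ML) => M' ? /IH E; exists M'; rewrite ?E.
- move=> L L1 L' pL F; rewrite (bagm_perm _ pL); congr (post _ (bagm _ _)).
  by elim: F => //= M M' K K' /IH-> _ ->.
Qed.

Lemma sum_eqv_means s (A B : sums s) : sum_eqv A B -> means A = means B.
Proof.
case=> AB BA; apply/seteqP; split=> p /means_In[a aA ap]; apply/means_In.
  by have [b bB /eqv_meaning E] := AB a aA; exists b; rewrite -?E.
by have [b bB /eqv_meaning E] := BA a aA; exists b; rewrite ?E.
Qed.

Lemma steps_means s (A B : sums s) : steps A B -> means A = means B.
Proof.
elim=> {A B} [A B /sum_eqv_means //|A B C [a [S [E [AE r BE]]]] _ <-].
by rewrite (sum_eqv_means AE) (sum_eqv_means BE) means_cons means_cat (red_sound r).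
Qed.

(** * Comparison with the interpretation in tuples *)

Definition tenv n (xs : n.-tuple nat) (a : n.-tuple {mset D}) : env :=
  fun x => nth mset0 a (index x xs).

Lemma tenv_out n (xs : n.-tuple nat) a x : x \notin xs -> tenv xs a x = mset0.
Proof. by move=> xxs; rewrite /tenv nth_default // memNindex // !size_tuple. Qed.

Lemma tenv_tnth n (xs : n.-tuple nat) a i : uniq xs -> tenv xs a (tnth xs i) = tnth a i.
Proof.
by move=> Uxs; rewrite /tenv (tnth_nth 0) index_uniq ?size_tuple // -tnth_nth.
Qed.

Lemma eq_tenv n (xs : n.-tuple nat) a f : uniq xs ->
  (forall i, tnth a i = f (tnth xs i)) -> (forall x, x \notin xs -> f x = mset0) ->
  tenv xs a = f.
Proof.
move=> Uxs af f0; apply: funext => x.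
have [/tnthP[i ->]|xxs] := boolP (x \in xs); first by rewrite tenv_tnth.
by rewrite tenv_out // f0.
Qed.

Lemma tenv_inj n (xs : n.-tuple nat) : uniq xs -> injective (tenv xs).
Proof.
by move=> Uxs a b E; apply: eq_from_tnth => i; rewrite -!(tenv_tnth _ i Uxs) E.
Qed.

Section Tenv.
Variables (n : nat) (xs : n.-tuple nat).
Hypothesis Uxs : uniq xs.

Lemma tenv_zero : tenv xs (tzero n) = ezero.
Proof. by apply: eq_tenv => // i; rewrite tnth_mktuple. Qed.

Lemma tenv_single i d : tenv xs (tsingle i d) = esingle (tnth xs i) d.
Proof.
apply: eq_tenv => // [j|x xxs]; rewrite ?tnth_mktuple /esingle.
  by rewrite (inj_eq (tuple_uniqP _ Uxs)).
by case: eqP xxs => // ->; rewrite mem_tnth.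
Qed.

Lemma tenv_add a b : tenv xs (tadd a b) = tenv xs a +e tenv xs b.
Proof.
apply: eq_tenv => // [i|x xxs]; first by rewrite tnth_mktuple /eadd !tenv_tnth.
by rewrite /eadd !tenv_out // msetD0.
Qed.

Lemma tenv_eq_zero a : tenv xs a = ezero -> a = tzero n.
Proof. by rewrite -tenv_zero; apply: tenv_inj. Qed.

(** A sum of multisets is empty only if both summands are, so the two parts are again supported on
    [xs] and come from tuples. *)
Lemma tenv_eq_add a f g : tenv xs a = f +e g ->
  exists b c, [/\ a = tadd b c, f = tenv xs b & g = tenv xs c].
Proof.
move=> E; have fg0 x : x \notin xs -> f x = mset0 /\ g x = mset0.
  by move=> xxs; apply: mset_add_eq0; rewrite -/(eadd f g x) -E tenv_out.
exists [tuple f (tnth xs i) | i < n], [tuple g (tnth xs i) | i < n].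
have fE : tenv xs [tuple f (tnth xs i) | i < n] = f.
  by apply: eq_tenv => // [i|x /fg0[]//]; rewrite tnth_mktuple.
have gE : tenv xs [tuple g (tnth xs i) | i < n] = g.
  by apply: eq_tenv => // [i|x /fg0[]//]; rewrite tnth_mktuple.
by split=> //; apply: (tenv_inj Uxs); rewrite tenv_add fE gE.
Qed.

Lemma uniq_scope : uniq (rcons (map S xs) 0).
Proof. by rewrite rcons_uniq (map_inj_uniq succn_inj) Uxs andbT; apply/mapP=> -[]. Qed.

(** The bound variable is last in the tuple but has index 0 in the environment. *)
Lemma tenv_scope (a : n.-tuple {mset D}) (b : {mset D}) :
  tenv [tuple of rcons [tuple of map S xs] 0] [tuple of rcons a b] = einsert 0 b (tenv xs a).
Proof.
apply: funext => -[|x]; rewrite ?einsert0S ?einsertE /tenv /= -(cats1 (map S xs)) index_cat.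
  case: mapP => [[]//|_] /=; rewrite size_map addn0 nth_rcons !size_tuple.
  by rewrite ltnn eqxx.
rewrite (mem_map succn_inj) (index_map succn_inj) nth_rcons size_tuple.
have := index_mem x xs; rewrite size_tuple.
case: (boolP (x \in xs)) => [_ ->//|xxs _].
(* For [x] outside [xs] the position is [n + 1], past the end of the extended tuple, so the empty
   default is read. *)
rewrite size_map size_tuple /= addn1 ltnNge leqW //= gtn_eqF //.
by rewrite memNindex // nth_default // !size_tuple.
Qed.

End Tenv.

Definition penv s n (xs : n.-tuple nat) : Defs.point s n -> env * out s :=
  match s return Defs.point s n -> env * out s with
  | Tm => fun p : n.-tuple {mset D} * D => (tenv xs p.1, p.2)
  | Bg => fun p : n.-tuple {mset D} * {mset D} => (tenv xs p.1, p.2)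
  | Ts => fun a => (tenv xs a, tt)
  end.

Lemma preimage_unions T T' (f : T -> T') Xs :
  f @^-1` unions Xs = unions [seq f @^-1` X | X <- Xs].
Proof.
elim: Xs => [|X Xs IH] /=; first by rewrite !unions_nil preimage_set0.
by rewrite !unions_cons preimage_setU IH.
Qed.

Lemma seq_mset_cons (K : choiceType) (x : K) s : seq_mset (x :: s) = (x +` seq_mset s)%mset.
Proof. by apply/msetP => y; rewrite mset1DE !mset_seqE /= eq_sym. Qed.

Section Translation.
Variables (n : nat) (xs : n.-tuple nat).
Hypothesis Uxs : uniq xs.

Lemma bang_tenv (Y : set (env * D)) a b :
  (exists2 qs : seq (Defs.point Tm n), forall q, List.In q qs -> Y (penv xs q) &
     (a, b) = (tsum [seq q.1 | q <- qs], seq_mset [seq q.2 | q <- qs])) <->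
  bang Y (tenv xs a, b).
Proof.
split=> [[qs Yqs [-> ->]]|[m]].
  elim: qs Yqs => [|q qs IH] Yqs /=.
    by exists 0; rewrite tenv_zero // seq_mset_nil.
  have [m Hm] := IH (fun q h => Yqs q (or_intror h)).
  exists m.+1, (tenv xs q.1), (tenv xs (tsum [seq q.1 | q <- qs])), q.2,
    (seq_mset [seq q.2 | q <- qs]).
  split=> //=; [by rewrite tenv_add|exact: seq_mset_cons|].
  by apply: (Yqs q); left.
elim: m a b => [|m IH] a b.
  by case=> /tenv_eq_zero -> // ->; exists [::]; rewrite //= seq_mset_nil.
case=> f1 [f2] [d] [b'] [/= /tenv_eq_add[]// a1 [a2] [-> -> ->] -> y /IH[qs Yqs [-> ->]]].
exists ((a1, d) :: qs); last by rewrite /= seq_mset_cons.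
by move=> q [<-|/Yqs].
Qed.

Lemma bag_interp_penv Xs (Y : set (env * D)) :
  bag_interp [seq @penv Tm n xs @^-1` X | X <- Xs] (@penv Tm n xs @^-1` Y) =
  @penv Bg n xs @^-1` bagm Xs (bang Y).
Proof.
apply/seteqP; split=> -[a b].
  case=> ps [qs] [F Yqs [-> ->]]; rewrite /preimage /=.
  elim: Xs ps F => [|X Xs IH] ps F.
    inversion F; subst; apply/bang_tenv; exists qs => //.
  inversion F as [|X' q Xs' ps' Xq F']; subst => /=.
  exists (tenv xs q.1), (tenv xs (tsum [seq q.1 | q <- ps' ++ qs])), q.2,
    (seq_mset [seq q.2 | q <- ps' ++ qs]).
  by split=> //=; [rewrite tenv_add|exact: seq_mset_cons|exact: IH].
rewrite /preimage /=; elim: Xs a b => [|X Xs IH] a b /=.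
  by move=> /bang_tenv[qs Yqs E]; exists [::], qs.
case=> f1 [f2] [d] [b'] [/= /tenv_eq_add[]// a1 [a2] [-> -> ->] -> y].
move=> /IH[ps] [qs] [F Yqs [-> ->]]; exists ((a1, d) :: ps), qs.
by split=> //=; [constructor|rewrite seq_mset_cons].
Qed.

Lemma test_interp_penv Xs :
  test_interp [seq @penv Tm n xs @^-1` X | X <- Xs] =
  @penv Ts n xs @^-1` post allstar (bagm Xs bag_nil).
Proof.
apply/seteqP; split=> a.
  case=> s F ->; rewrite /preimage /=; elim: Xs s F => [|X Xs IH] s F.
    by inversion F; exists mset0 => [d|]; rewrite ?in_mset0 //= tenv_zero.
  inversion F as [|X' c Xs' s' Xc F']; subst => /=; have [b bs B] := IH _ F'.
  exists (Dstar +` b)%mset; first by apply/allstarD; split=> //; apply/allstar1.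
  by exists (tenv xs c), (tenv xs (tsum s')), Dstar, b; split; rewrite //= tenv_add.
rewrite /preimage /= => -[b bs]; elim: Xs a b bs => [|X Xs IH] a b bs.
  by case=> /tenv_eq_zero -> // _; exists [::].
case=> f1 [f2] [d] [b'] [/= /tenv_eq_add[]// a1 [a2] [-> -> ->] bE x].
move: bs; rewrite bE => /allstarD[/allstar1 ds bs'] /(IH _ _ bs')[s F ->].
by exists (a1 :: s) => //; constructor; rewrite // -ds.
Qed.

End Translation.

Lemma interp_meaning s (e : expr s) n (xs : n.-tuple nat) : uniq xs ->
  interp e xs = @penv s n xs @^-1` meaning e.
Proof.
elim/expr_ind_nested: s / e n xs => /= [x|M IH|M P IHM IHP|V IH|L B IHL IHB|L IHL] n xs Uxs.
- apply/seteqP; split=> -[a d] /=.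
    by case=> i [e] [<- [-> ->]]; rewrite /preimage /= tenv_single.
  rewrite /preimage /= => E; have [/tnthP[i xE]|xxs] := boolP (x \in xs).
    exists i, d; split=> //; congr pair; apply: (tenv_inj Uxs).
    by rewrite tenv_single // -xE.
  (* A variable outside [xs] has empty interpretation, and no tuple environment gives it the element
     [d]. *)
  move/(congr1 (fun f => f x)): E; rewrite tenv_out // /esingle eqxx.
  by move=> /msetP/(_ d); rewrite msetnxx mset0E.
- have {}IH a d := congr1 (fun X : set _ => X (a, d))
    (IH _ [tuple of rcons [tuple of map S xs] 0] (uniq_scope Uxs)).
  apply/seteqP; split=> -[a o].
    case=> a' [b] [d] [[-> ->]]; rewrite IH /preimage /= tenv_scope => H.
    by exists b, d.
  case=> b [d] [/= ->]; rewrite -(tenv_scope xs) => H; exists a, b, d.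
  by rewrite IH.
- rewrite IHM // IHP //; apply/seteqP; split=> -[a d].
    case=> a1 [a2] [b] [e] [[-> ->] m p].
    by exists (tenv xs a1), (tenv xs a2), (Dcons b e), b; rewrite /= tenv_add.
  case=> f1 [f2] [d'] [b] [/= /tenv_eq_add[]// a1 [a2] [-> -> ->] -> m p].
  by exists a1, a2, b, d.
- rewrite IH //; apply/seteqP; split=> -[a d].
    by case=> a' v [-> ->]; exists tt.
  by case=> -[] /= -> v; exists a.
- rewrite -bag_interp_penv // preimage_unions -!map_comp; congr (bag_interp _ (unions _)).
    exact: (map_all_tm (fun M (H : forall n xs, _) => H n xs Uxs) IHL).
  exact: (map_all_tm (fun M (H : forall n xs, _) => H n xs Uxs) IHB).
- rewrite -test_interp_penv // -!map_comp; congr test_interp.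
  exact: (map_all_tm (fun M (H : forall n xs, _) => H n xs Uxs) IHL).
Qed.

Lemma interp_sum_means s (A : sums s) n (xs : n.-tuple nat) : uniq xs ->
  interp_sum A xs = @penv s n xs @^-1` means A.
Proof.
move=> Uxs; rewrite preimage_unions -map_comp; congr unions.
by apply: eq_map => a; apply: interp_meaning.
Qed.

Theorem theorem7p12 (s : kind) (A B : sums s) (n : nat) (xs : n.-tuple nat) :
  uniq xs -> {subset fv_sum A <= xs} -> steps A B ->
  interp_sum A xs = interp_sum B xs.
Proof.
by move=> Uxs _ /steps_means E; rewrite !interp_sum_means // E.
Qed.
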